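(* Let $A$ be a gendo-Frobenius algebra with the comultiplication $\Delta: A\rightarrow A\otimes_k A$ constructed in the context (from any choice of the data $e,\sigma,\tau$ there). Then $(A,\Delta)$ has a counit if and only if $A$ is Frobenius.
   Context: $k$ is an arbitrary field; all algebras and modules are finite dimensional over $k$. $\mathrm{D}=\mathrm{Hom}_k(-,k)$; $\mathrm{D}(A)$ is an $A$-bimodule via $(afb)(x)=f(bxa)$. For an automorphism $\omega$ of an algebra and a right module $N$ over it, $N_\omega$ is the vector space $N$ with right action $n\cdot a=n\,\omega(a)$ (left action, if any, unchanged). A finite dimensional $k$-algebra $B$ is Frobenius if $B\cong \mathrm{D}(B)$ as left (equivalently right) $B$-modules. A Nakayama automorphism $\nu_B$ of a Frobenius algebra $B$ is an automorphism with $B_{\nu_B}\cong \mathrm{D}(B)$ as $B$-bimodules. A finite dimensional $k$-algebra $A$ is called gendo-Frobenius if it satisfies one of the following equivalent conditions (the equivalence is a theorem of Kerner and Yamagata): (i) $A$ is isomorphic to $\mathrm{End}_B(M)$ for a finite dimensional faithful right module $M$ over a Frobenius algebra $B$ such that $M\cong M_{\nu_B}$ as right $B$-modules; (ii) $\mathrm{Hom}_A(\mathrm{D}(A),A)\cong A$ as left $A$-modules, where $\mathrm{Hom}_A$ denotes homomorphisms of left $A$-modules and the left $A$-action is $(af)(x)=f(xa)$. Construction of $\Delta$. An idempotent $e$ of $A$ is self-dual if $\mathrm{D}(eA)\cong Ae$ as left $A$-modules, and faithful if both $Ae$ and $eA$ are faithful $A$-modules. A gendo-Frobenius algebra $A$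 has a faithful and self-dual idempotent $e$; then there are $\sigma\in\mathrm{Aut}(A)$ and an isomorphism $\tau:eA_\sigma\to \mathrm{D}(Ae)$ of $(eAe,A)$-bimodules (the bimodule structure on $\mathrm{D}(Ae)$ being $(cfa)(y)=f(ayc)$). Fix such $e,\sigma,\tau$. There is an $A$-bimodule isomorphism $\gamma: Ae\otimes_{eAe}eA_\sigma\to \mathrm{D}(A)$, $\gamma(ae\otimes eb)(x)=\tau(eb\,\sigma(x))(ae)$ for $a,b,x\in A$. Let $m:\mathrm{D}(A)\otimes_k\mathrm{D}(A)\to\mathrm{D}(A)$ be the $A$-bimodule morphism given by $m(\gamma(ae\otimes eb)\otimes_k\gamma(ce\otimes ed))=\gamma(aebce\otimes ed)$ for $a,b,c,d\in A$. Then $\Delta:A\to A\otimes_kA$ is the $k$-linear map dual to $m$, determined by $(f\otimes g)\Delta(x)=m(g\otimes f)(x)$ for all $f,g\in\mathrm{D}(A)$, $x\in A$, where $(f\otimes g)(u\otimes v)=f(u)g(v)$. A counit of $(A,\Delta)$ is $\delta\in\mathrm{D}(A)$ with $(\delta\otimes1)\Delta=\mathrm{id}_A=(1\otimes\delta)\Delta$. *)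

(* Defs.v *)
From HB Require Import structures.
From mathcomp Require Import all_boot all_order all_algebra all_field.

Set Implicit Arguments.
Unset Strict Implicit.
Unset Printing Implicit Defensive.

Import GRing.Theory.
Local Open Scope ring_scope.

(* Tensor products over k.  U (x) V is realised by matrices in the standard
   bases of U and V; [tlift_tens] is its universal property. *)
Section Tensor.
Variable k : fieldType.

Definition bilinear_map (U V W : vectType k) (b : U -> V -> W) : Prop :=
  (forall u, linear (b u)) /\ (forall v, linear (b^~ v)).

Definition tensor (U V : vectType k) : vectType k :=
  'M[k]_(\dim {:U}, \dim {:V}).

Definition tens (U V : vectType k) (u : U) (v : V) : tensor U V :=
  \matrix_(i, j) (coord (vbasis {:U}) i u * coord (vbasis {:V}) j v).

(* The linear map U (x) V -> W induced by the bilinear map b. *)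
Definition tlift (U V W : vectType k) (b : U -> V -> W)
    (t : tensor U V) : W :=
  \sum_i \sum_j t i j *: b (vbasis {:U})`_i (vbasis {:V})`_j.

Lemma tens_bilinear (U V : vectType k) : bilinear_map (@tens U V).
Proof.
split=> [u | v] a x y; apply/matrixP=> i j; rewrite !mxE linearP.
  by rewrite mulrDr mulrCA.
by rewrite mulrDl mulrA.
Qed.

Lemma tlift_linear (U V W : vectType k) (b : U -> V -> W) :
  linear (tlift b).
Proof.
move=> a s t; rewrite /tlift scaler_sumr -big_split; apply: eq_bigr => i _.
rewrite scaler_sumr -big_split; apply: eq_bigr => j _.
by rewrite !mxE scalerDl scalerA.
Qed.

Lemma tlift_tens (U V W : vectType k) (b : U -> V -> W) :
  bilinear_map b -> forall u v, tlift b (tens u v) = b u v.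
Proof.
move=> [br bl] u v.
pose Lr x : {linear V -> W} := HB.pack (b x)
  (GRing.isLinear.Build _ _ _ _ (b x) (br x)).
pose Ll y : {linear U -> W} := HB.pack (b^~ y)
  (GRing.isLinear.Build _ _ _ _ (b^~ y) (bl y)).
have uE := coord_vbasis (memvf u); have vE := coord_vbasis (memvf v).
rewrite -[RHS]/(Ll v u) {2}uE linear_sum; apply: eq_bigr => i _.
rewrite linearZ_LR -[Ll v _]/(Lr (vbasis {:U})`_i v) {2}vE linear_sum.
rewrite scaler_sumr; apply: eq_bigr => j _.
by rewrite linearZ_LR /= mxE scalerA.
Qed.

End Tensor.

Section Duality.
Variable k : fieldType.

Definition dual (V : vectType k) : vectType k := 'Hom(V, k^o).

(* f (x) g as a linear form on U (x) V. *)
Definition tens_form (U V : vectType k) (f : dual U) (g : dual V) :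
    tensor U V -> k^o :=
  tlift (fun u v => f u * g v : k^o).

(* d (x) 1 and 1 (x) d, with k (x) V and V (x) k identified with V. *)
Definition form_tens_id (V : vectType k) (d : dual V) : tensor V V -> V :=
  tlift (fun u v => (d u : k) *: v).

Definition id_tens_form (V : vectType k) (d : dual V) : tensor V V -> V :=
  tlift (fun u v => (d v : k) *: u).

End Duality.

Section DualBimodule.
Variables (k : fieldType) (A : falgType k).

(* (a f)(x) = f (x a) *)
Definition dual_lact (a : A) (f : dual A) : dual A := (f \o amulr a)%VF.

(* (f b)(x) = f (b x) *)
Definition dual_ract (f : dual A) (b : A) : dual A := (f \o amull b)%VF.

Definition frobenius : Prop :=
  exists phi : 'Hom(A, dual A),
    bijective phi /\ forall a x, phi (a * x) = dual_lact a (phi x).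

(* The bimodule isomorphism phi : A_nu -> D(A). *)
Definition nakayama_automorphism (nu : 'AEnd(A)) : Prop :=
  bijective nu /\
  exists phi : 'Hom(A, dual A),
    bijective phi /\
    forall a x b, phi (a * x * nu b) = dual_ract (dual_lact a (phi x)) b.

End DualBimodule.

(* A finite dimensional right B-module structure on M; [rm_act b n] is n b. *)
Record right_module (k : fieldType) (B : falgType k) (M : vectType k) := {
  rm_act : 'Hom(B, 'End(M));
  rm_act1 : forall n, rm_act 1 n = n;
  rm_actM : forall b c n, rm_act (b * c) n = rm_act c (rm_act b n)
}.

Section GendoFrobenius.
Variables (k : fieldType) (A : falgType k).

Definition rm_faithful (B : falgType k) (M : vectType k)
    (r : right_module B M) : Prop :=
  forall b, (forall n, rm_act r b n = 0) -> b = 0.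

(* M is isomorphic to M_nu. *)
Definition rm_twist_iso (B : falgType k) (M : vectType k)
    (r : right_module B M) (nu : 'AEnd(B)) : Prop :=
  exists theta : 'End(M), bijective theta /\
    forall b n, theta (rm_act r b n) = rm_act r (nu b) (theta n).

Definition rm_endo (B : falgType k) (M : vectType k)
    (r : right_module B M) (h : 'End(M)) : Prop :=
  forall b n, h (rm_act r b n) = rm_act r b (h n).

(* phi is an algebra isomorphism from A onto End_B(M). *)
Definition algebra_iso_End (B : falgType k) (M : vectType k)
    (r : right_module B M) (phi : 'Hom(A, 'End(M))) : Prop :=
  [/\ injective phi,
      forall h, rm_endo r h <-> exists a, phi a = h,
      phi 1 = \1%VF
    & forall a b, phi (a * b) = (phi a \o phi b)%VF].

Definition gendo_frobenius_End : Prop :=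
  exists (B : falgType k) (nu : 'AEnd(B)) (M : vectType k)
         (r : right_module B M),
    [/\ frobenius B, nakayama_automorphism nu, rm_faithful r,
        rm_twist_iso r nu
      & exists phi : 'Hom(A, 'End(M)), algebra_iso_End r phi].

(* Phi is an isomorphism of left modules A -> Hom_A(D(A), A), the latter
   having the left action (a f)(x) = f (x a). *)
Definition gendo_frobenius_Hom : Prop :=
  exists Phi : 'Hom(A, 'Hom(dual A, A)),
    [/\ injective Phi,
        forall h : 'Hom(dual A, A),
          (forall a x, h (dual_lact a x) = a * h x) <-> exists b, Phi b = h
      & forall a b x, Phi (a * b) x = Phi b (dual_ract x a)].

(* The two conditions are equivalent, by a theorem of Kerner and Yamagata. *)
Definition gendo_frobenius : Prop :=
  gendo_frobenius_End \/ gendo_frobenius_Hom.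

End GendoFrobenius.

Section Idempotent.
Variables (k : fieldType) (A : falgType k) (e : A).

(* The vector spaces Ae, eA and eAe, as types. *)
Definition Ae : vectType k := subvs_of (limg (amulr e)).
Definition eA : vectType k := subvs_of (limg (amull e)).
Definition eAe : vectType k := subvs_of (limg (amull e \o amulr e)%VF).

Definition in_Ae (a : A) : Ae := vsproj _ (a * e).
Definition in_eA (a : A) : eA := vsproj _ (e * a).

(* The actions on Ae and eA.  Since [vsproj] is the identity on the subspace,
   these are plain products in A as soon as e is idempotent. *)
Definition Ae_lact (a : A) (y : Ae) : Ae := vsproj _ (a * vsval y).
Definition Ae_ract (y : Ae) (c : eAe) : Ae := vsproj _ (vsval y * vsval c).
Definition eA_ract (u : eA) (a : A) : eA := vsproj _ (vsval u * a).
Definition eA_lact (c : eAe) (u : eA) : eA := vsproj _ (vsval c * vsval u).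

Definition self_dual_idempotent : Prop :=
  exists psi : 'Hom(dual eA, Ae), bijective psi /\
    forall (a : A) (f g : dual eA),
      (forall u, g u = f (eA_ract u a)) -> psi g = Ae_lact a (psi f).

Definition faithful_idempotent : Prop :=
  (forall a, (forall y, Ae_lact a y = 0) -> a = 0) /\
  (forall a, (forall u, eA_ract u a = 0) -> a = 0).

(* tau : eA_sigma -> D(Ae) is an isomorphism of (eAe, A)-bimodules. *)
Definition eA_twist_iso (sigma : 'AEnd(A)) (tau : 'Hom(eA, dual Ae)) : Prop :=
  bijective tau /\
  forall (c : eAe) (u : eA) (a : A) (y : Ae),
    tau (eA_ract (eA_lact c u) (sigma a)) y = tau u (Ae_ract (Ae_lact a y) c).

(* The tensor product of Ae and eA over eAe: the quotient of Ae (x)_k eA by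
   the span of the yc (x) u - y (x) cu, realised as a complement of it with
   the projection along it.  [tlift_btens] is its universal property. *)
Definition balance_rel : {vspace tensor Ae eA} :=
  (\sum_(i < \dim {:Ae}) \sum_(j < \dim {:eAe}) \sum_(l < \dim {:eA})
     <[tens (Ae_ract (vbasis {:Ae})`_i (vbasis {:eAe})`_j) (vbasis {:eA})`_l
       - tens (vbasis {:Ae})`_i
              (eA_lact (vbasis {:eAe})`_j (vbasis {:eA})`_l)]>)%VS.

Definition AeeA : vectType k := subvs_of (balance_rel^C)%VS.

Definition btens (y : Ae) (u : eA) : AeeA :=
  vsproj _ (daddv_pi (balance_rel^C)%VS balance_rel (tens y u)).

Lemma btens_balanced (y : Ae) (c : eAe) (u : eA) :
  btens (Ae_ract y c) u = btens y (eA_lact c u).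
Proof.
have vb_ind (V : vectType k) (P : V -> Prop) :
    (forall a x z, P x -> P z -> P (a *: x + z)) ->
    P 0 ->
    (forall i : 'I_(\dim {:V}), P (vbasis {:V})`_i) -> forall x, P x.
  move=> PD P0 Pb x; rewrite (coord_vbasis (memvf x)).
  by elim/big_ind: _ => // [? ? ? ?|i _]; [rewrite -[X in X + _]scale1r|
    rewrite -[X in P X]addr0]; apply: PD.
have lin0 (V W : vectType k) (f : V -> W) :
    (forall a x z, f (a *: x + z) = a *: f x + f z) -> f 0 = 0.
  by move=> /(_ (-1) 0 0); rewrite scaler0 addr0 scaleN1r addNr.
pose T y c u := tens (Ae_ract y c) u - tens y (eA_lact c u).
have [tr tl] : bilinear_map (@tens k Ae eA) := @tens_bilinear k Ae eA.
have Tu y0 c0 a x z : T y0 c0 (a *: x + z) = a *: T y0 c0 x + T y0 c0 z.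
  rewrite /T /eA_lact linearP mulrDr -scalerAr linearP !tr.
  by rewrite scalerBr opprD addrACA.
have Tc y0 u0 a x z : T y0 (a *: x + z) u0 = a *: T y0 x u0 + T y0 z u0.
  rewrite /T /eA_lact /Ae_ract !linearP mulrDr mulrDl -scalerAr -scalerAl.
  rewrite !linearP tr [LHS](congr1 (fun w => w - _) (tl _ _ _ _)).
  by rewrite scalerBr opprD addrACA.
have Ty c0 u0 a x z : T (a *: x + z) c0 u0 = a *: T x c0 u0 + T z c0 u0.
  rewrite /T /Ae_ract linearP mulrDl -scalerAl linearP.
  rewrite [LHS](congr2 (fun w w' => w - w') (tl _ _ _ _) (tl _ _ _ _)).
  by rewrite scalerBr opprD addrACA.
have TR : T y c u \in balance_rel.
  elim/(vb_ind Ae): y => [a x z Tx Tz||i]; first by rewrite Ty rpredD ?rpredZ.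
    by rewrite [T _ _ _](lin0 _ _ (fun x => T x c u)) ?rpred0.
  elim/(vb_ind eAe): c => [a x z Tx Tz||j]; first by rewrite Tc rpredD ?rpredZ.
    by rewrite [T _ _ _](lin0 _ _ (fun x => T _ x u)) ?rpred0.
  elim/(vb_ind eA): u => [a x z Tx Tz||l]; first by rewrite Tu rpredD ?rpredZ.
    by rewrite [T _ _ _](lin0 _ _ (T _ _)) ?rpred0.
  apply: (subvP _ _ (memv_line _)).
  apply: (sumv_sup i) => //; apply: (sumv_sup j) => //.
  exact: (sumv_sup l).
apply/eqP; rewrite -subr_eq0 /btens -!linearB /= -/(T y c u).
have dRC : (balance_rel :&: balance_rel^C = 0)%VS := capv_compl _.
have := daddv_pi_add dRC; rewrite addv_complf => /(_ _ (memvf _)).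
move=> /(_ (T y c u)); rewrite (daddv_pi_id dRC TR).
by move/(canRL (addKr _)); rewrite addNr => ->; rewrite linear0.
Qed.

Lemma tlift_btens (W : vectType k) (b : Ae -> eA -> W) :
    bilinear_map b ->
    (forall y c u, b (Ae_ract y c) u = b y (eA_lact c u)) ->
  forall y u, tlift b (vsval (btens y u)) = b y u.
Proof.
move=> bb bal y u.
pose L : {linear tensor Ae eA -> W} := HB.pack (tlift b)
  (GRing.isLinear.Build _ _ _ _ (tlift b) (tlift_linear b)).
have kerL t : t \in balance_rel -> L t = 0.
  suff sub : (balance_rel <= lker (linfun L))%VS.
    by move/(subvP sub); rewrite memv_ker lfunE => /eqP.
  do 3![apply/subv_sumP => ? _].
  rewrite -memvE memv_ker lfunE linearB /= !tlift_tens // bal subrr //.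
rewrite -[LHS]/(L _) vsprojK ?memv_pi //.
have := daddv_pi_add (capv_compl balance_rel); rewrite addv_complf.
move=> /(_ _ (memvf (tens y u))) e0.
rewrite -[RHS]tlift_tens // -[RHS]/(L (tens y u)) -(congr1 L e0).
have k0 := kerL _ (memv_pi balance_rel (balance_rel^C)%VS (tens y u)).
by rewrite [RHS](linearD L) k0 add0r.
Qed.

End Idempotent.

Section Comultiplication.
Variables (k : fieldType) (A : falgType k).

(* gamma(ae (x) eb)(x) = tau(eb sigma(x))(ae) *)
Definition is_gamma (e : A) (sigma : 'AEnd(A)) (tau : 'Hom(eA e, dual (Ae e)))
    (gamma : 'Hom(AeeA e, dual A)) : Prop :=
  forall a b x : A,
    gamma (btens (in_Ae e a) (in_eA e b)) x
      = tau (eA_ract (in_eA e b) (sigma x)) (in_Ae e a).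

Definition is_mult (e : A) (gamma : 'Hom(AeeA e, dual A))
    (m : 'Hom(tensor (dual A) (dual A), dual A)) : Prop :=
  forall a b c d : A,
    m (tens (gamma (btens (in_Ae e a) (in_eA e b)))
            (gamma (btens (in_Ae e c) (in_eA e d))))
      = gamma (btens (in_Ae e (a * e * b * c)) (in_eA e d)).

(* The two factors are exchanged: (f (x) g) Delta(x) = m(g (x) f)(x). *)
Definition is_comult (m : 'Hom(tensor (dual A) (dual A), dual A))
    (Delta : 'Hom(A, tensor A A)) : Prop :=
  forall (f g : dual A) (x : A), tens_form f g (Delta x) = m (tens g f) x.

Definition is_counit (Delta : 'Hom(A, tensor A A)) (delta : dual A) : Prop :=
  (forall x, form_tens_id delta (Delta x) = x) /\
  (forall x, id_tens_form delta (Delta x) = x).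

End Comultiplication.

(* Main.v *)
(** Dually to Delta, m makes D(A) an algebra, and a counit of Delta is the same
    as a two-sided unit of m.  Let mu : Ae (x)_{eAe} eA -> A be multiplication;
    gamma is onto because eA is faithful, and m(gamma t (x) f) = mu(t) f.
    - If d is a unit then a d = 0 forces a f = m(a d (x) f) = 0 for all f, hence
      a = 0; so a |-> a d is an isomorphism from A to D(A).
    - If A is Frobenius, with phi : A -> D(A), a linear form phi a vanishing on
      the ideal AeA satisfies phi(u a)(x) = phi(a)(x u) = 0 for u in eA, so
      eA a = 0 and a = 0.  Thus AeA = A, and for mu(t) = 1 the form gamma t is a
      unit: on the left by the formula above, on the right by balancedness. *)
Require Import Defs.
From HB Require Import structures.
From mathcomp Require Import all_boot all_order all_algebra all_field.

Set Implicit Arguments.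
Unset Strict Implicit.
Unset Printing Implicit Defensive.

Import GRing.Theory.
Local Open Scope ring_scope.

(** * Separation and dimension arguments for linear forms *)

Section LinearForms.
Variable k : fieldType.
Implicit Types U V : vectType k.

Definition mk_hom U V (f : U -> V) (f_lin : linear f) : 'Hom(U, V) :=
  linfun (HB.pack_for {linear U -> V} f
    (GRing.isLinear.Build k U V _ f f_lin)).

Lemma mk_homE U V (f : U -> V) (f_lin : linear f) x : mk_hom f_lin x = f x.
Proof. exact: lfunE. Qed.

Lemma hom_linearP U V (f : 'Hom(U, V)) a x y : f (a *: x + y) = a *: f x + f y.
Proof. exact: linearP. Qed.

Lemma dim_dual V : \dim {:dual V} = \dim {:V}.
Proof. by rewrite !dimvf; apply: muln1. Qed.

Lemma lfun_inj_bij U V (f : 'Hom(U, V)) :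
  injective f -> \dim {:U} = \dim {:V} -> bijective f.
Proof.
move=> /lker0P kerf dimUV.
have limgf : limg f = fullv.
  apply/eqP; rewrite eqEdim subvf -dimUV limg_dim_eq ?leqnn //.
  by rewrite (eqP kerf) capv0.
exists (f^-1)%VF => x; first exact: lker0_lfunK.
by apply: limg_lfunVK; rewrite limgf memvf.
Qed.

Lemma dual_separates V (v : V) : (forall f : dual V, f v = 0) -> v = 0.
Proof.
move=> v0; rewrite (coord_vbasis (memvf v)); apply: big1 => i _.
have ci_lin : linear (coord (vbasis {:V}) i : V -> k^o).
  by move=> a x y; rewrite linearP.
by have := v0 (mk_hom ci_lin); rewrite mk_homE => ->; rewrite scale0r.
Qed.

(** A form composed with the projection onto [W^C] along [W] vanishes on [W], hence is zero; since
    forms separate points, the projection itself is zero. *)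
Lemma forms_vanishing_full V (W : {vspace V}) :
  (forall f : dual V, (forall w, w \in W -> f w = 0) -> f = 0) -> W = fullv.
Proof.
move=> vanish; apply/eqP; rewrite eqEsubv subvf /=; apply/subvP => v _.
have dW : (W^C :&: W = 0)%VS by rewrite capvC capv_compl.
suff p0 : daddv_pi W^C W v = 0.
  have := daddv_pi_add dW (w := v); rewrite addvC addv_complf p0 add0r.
  by move=> /(_ (memvf v)) <-; apply: memv_pi.
apply: dual_separates => f; rewrite -[LHS](comp_lfunE f (daddv_pi W^C W) v).
rewrite (vanish (f \o daddv_pi W^C W)%VF) ?lfunE // => w Ww.
rewrite comp_lfunE; set z := daddv_pi _ _ _.
suff -> : z = 0 by rewrite linear0.
have := daddv_pi_add dW (w := w); rewrite addvC addv_complf => /(_ (memvf w)).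
rewrite (daddv_pi_id (capv_compl W) Ww) -/z.
by move/(canRL (addrK _)); rewrite subrr.
Qed.

(** Evaluation embeds [V] into the dual of [W], so [\dim W] is at least [\dim {:V}], which is the
    dimension of [dual V]. *)
Lemma separating_forms_full V (W : {vspace dual V}) :
  (forall v, (forall f : dual V, f \in W -> f v = 0) -> v = 0) -> W = fullv.
Proof.
move=> sepW; pose ev v (f : subvs_of W) : k^o := (vsval f : dual V) v.
have ev_lin v : linear (ev v).
  by move=> a f g; rewrite /ev linearP add_lfunE scale_lfunE.
pose E v : dual (subvs_of W) := mk_hom (ev_lin v).
have E_lin : linear E.
  move=> a x y; apply/lfunP => f.
  by rewrite add_lfunE scale_lfunE !mk_homE /ev linearP.
have E_inj : lker (mk_hom E_lin) == 0%VS.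
  rewrite -subv0; apply/subvP => v; rewrite memv_ker memv0 mk_homE => /eqP Ev0.
  apply/eqP/sepW => f Wf; have := congr1 (fun h : dual _ => h (vsproj W f)) Ev0.
  by rewrite zero_lfunE mk_homE /ev vsprojK.
apply/eqP; rewrite eqEdim subvf dim_dual.
have <- : \dim (limg (mk_hom E_lin)) = \dim {:V}.
  by apply: limg_dim_eq; rewrite (eqP E_inj) capv0.
apply: leq_trans (dimvS (subvf _)) _; rewrite dim_dual.
by rewrite dimvf.
Qed.

End LinearForms.

(** * Contractions and expansions of tensors *)

Section TensorContraction.
Variables (k : fieldType) (V : vectType k).

(** Testing a contraction against a form gives a value of [tens_form], the shape in which
    [is_comult] describes [Delta]. *)
Lemma tens_formE (f d : dual V) (t : tensor V V) :
  tens_form f d t = f (id_tens_form d t).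
Proof.
rewrite /tens_form /id_tens_form /tlift linear_sum; apply: eq_bigr => i _.
rewrite linear_sum; apply: eq_bigr => j _.
rewrite [RHS]linearZ_LR; congr (_ *: _).
by rewrite linearZ_LR; exact: (@mulrC k).
Qed.

Lemma form_tensE (f d : dual V) (t : tensor V V) :
  tens_form d f t = f (form_tens_id d t).
Proof.
rewrite /tens_form /form_tens_id /tlift linear_sum; apply: eq_bigr => i _.
rewrite linear_sum; apply: eq_bigr => j _.
by rewrite [RHS]linearZ_LR; congr (_ *: _); rewrite linearZ_LR.
Qed.

Lemma tensPl (U W : vectType k) a (x y : U) (z : W) :
  tens (a *: x + y) z = a *: tens x z + tens y z.
Proof. by have [_ /(_ z)] := @tens_bilinear k U W; apply. Qed.

Lemma tensPr (U W : vectType k) a (x y : W) (z : U) :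
  tens z (a *: x + y) = a *: tens z x + tens z y.
Proof. by have [/(_ z) + _] := @tens_bilinear k U W; apply. Qed.

(** The matrix units are the tensors of basis vectors. *)
Lemma tens_sum (U W : vectType k) (t : tensor U W) :
  t = \sum_i \sum_j (t : 'M_(_, _)) i j *:
    tens (vbasis {:U})`_i (vbasis {:W})`_j.
Proof.
rewrite {1}[t]matrix_sum_delta; apply: eq_bigr => i _; apply: eq_bigr => j _.
congr (_ *: _); apply/matrixP => i1 j1; rewrite !mxE.
have freeb (X : vectType k) : free (vbasis {:X}) := basis_free (vbasisP _).
by rewrite !coord_free // ![_ == i1]eq_sym ![_ == j1]eq_sym -natrM mulnb.
Qed.

End TensorContraction.

(** * The left module [D(A)] and cyclic generators of it *)

Section Frobenius.
Variables (k : fieldType) (A : falgType k).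

Lemma dual_lactE a (f : dual A) x : dual_lact a f x = f (x * a).
Proof. by rewrite comp_lfunE lfunE. Qed.

Lemma dual_lactM a b (f : dual A) :
  dual_lact (a * b) f = dual_lact a (dual_lact b f).
Proof. by apply/lfunP => x; rewrite !dual_lactE mulrA. Qed.

Lemma dual_lactP (b : A) a (f g : dual A) :
  dual_lact b (a *: f + g) = a *: dual_lact b f + dual_lact b g.
Proof. by rewrite /dual_lact comp_lfunDl comp_lfunZl. Qed.

(** The map [a |-> a d] is left linear, and an injection between spaces of equal dimension is
    bijective. *)
Lemma frobenius_generator (d : dual A) :
  (forall a, dual_lact a d = 0 -> a = 0) -> frobenius A.
Proof.
move=> d_inj; pose L a := dual_lact a d.
have L_lin : linear L.
  move=> c a b; apply/lfunP => x.
  by rewrite add_lfunE scale_lfunE !dual_lactE mulrDr -scalerAr hom_linearP.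
have phiE := mk_homE L_lin; set phi := mk_hom L_lin in phiE.
exists phi; split=> [|a x]; last first.
  by rewrite !phiE; exact: dual_lactM.
apply: lfun_inj_bij; last by rewrite dim_dual.
apply: raddf_inj => a /= pa0; apply: d_inj.
exact: etrans (esym (phiE a)) pa0.
Qed.

End Frobenius.

(** * Calculus in [Ae], [eA], [eAe] and the balanced tensor product *)

Section Idempotent.
Variables (k : fieldType) (A : falgType k) (e : A).
Hypothesis he : e * e = e.
Implicit Types (y : Ae e) (u : eA e) (c : eAe e).

Lemma vsval_in_Ae a : vsval (in_Ae e a) = a * e.
Proof.
by rewrite vsprojK //; apply/memv_imgP; exists a; rewrite ?memvf ?lfunE.
Qed.

Lemma vsval_in_eA a : vsval (in_eA e a) = e * a.
Proof.
by rewrite vsprojK //; apply/memv_imgP; exists a; rewrite ?memvf ?lfunE.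
Qed.

Lemma vsval_Ae_idem y : vsval y * e = vsval y.
Proof. by have /memv_imgP[a _ ->] := subvsP y; rewrite lfunE /= -mulrA he. Qed.

Lemma vsval_eA_idem u : e * vsval u = vsval u.
Proof. by have /memv_imgP[a _ ->] := subvsP u; rewrite lfunE /= mulrA he. Qed.

Lemma in_Ae_vsval y : in_Ae e (vsval y) = y.
Proof. by rewrite /in_Ae vsval_Ae_idem vsvalK. Qed.

Lemma in_eA_vsval u : in_eA e (vsval u) = u.
Proof. by rewrite /in_eA vsval_eA_idem vsvalK. Qed.

(** Writing [y] as [y e] shows that the product already lies in [Ae], where [vsproj] changes
    nothing. The other three actions are treated alike. *)
Lemma vsval_Ae_lact a y : vsval (Ae_lact a y) = a * vsval y.
Proof.
rewrite /Ae_lact -[in LHS](vsval_Ae_idem y) mulrA -/(in_Ae e _) vsval_in_Ae.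
by rewrite -mulrA vsval_Ae_idem.
Qed.

Lemma vsval_eA_ract u a : vsval (eA_ract u a) = vsval u * a.
Proof.
rewrite /eA_ract -[in LHS](vsval_eA_idem u) -mulrA -/(in_eA e _) vsval_in_eA.
by rewrite mulrA vsval_eA_idem.
Qed.

Lemma vsval_eAe_ridem c : vsval c * e = vsval c.
Proof.
by have /memv_imgP[a _ ->] := subvsP c; rewrite comp_lfunE !lfunE /= -!mulrA he.
Qed.

Lemma vsval_eAe_lidem c : e * vsval c = vsval c.
Proof.
by have /memv_imgP[a _ ->] := subvsP c; rewrite comp_lfunE !lfunE /= mulrA he.
Qed.

Lemma vsval_Ae_ract y c : vsval (Ae_ract y c) = vsval y * vsval c.
Proof.
rewrite /Ae_ract -[in LHS](vsval_eAe_ridem c) mulrA -/(in_Ae e _) vsval_in_Ae.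
by rewrite -mulrA vsval_eAe_ridem.
Qed.

Lemma vsval_eA_lact c u : vsval (eA_lact c u) = vsval c * vsval u.
Proof.
rewrite /eA_lact -[in LHS](vsval_eAe_lidem c) -mulrA -/(in_eA e _) vsval_in_eA.
by rewrite mulrA vsval_eAe_lidem.
Qed.

(** The identity of the algebra [eAe]; acting by it isolates the [A]-linearity of [tau]. *)
Definition eAe_one : eAe e := vsproj _ e.

Lemma vsval_eAe_one : vsval eAe_one = e.
Proof.
rewrite vsprojK //; apply/memv_imgP; exists 1; rewrite ?memvf //.
by rewrite comp_lfunE !lfunE /= mul1r he.
Qed.

Lemma eA_lact1 u : eA_lact eAe_one u = u.
Proof.
by apply: subvs_inj; rewrite vsval_eA_lact vsval_eAe_one vsval_eA_idem.
Qed.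

Lemma Ae_ract1 y : Ae_ract y eAe_one = y.
Proof.
by apply: subvs_inj; rewrite vsval_Ae_ract vsval_eAe_one vsval_Ae_idem.
Qed.

Lemma btensPr a y u1 u2 :
  btens y (a *: u1 + u2) = a *: btens y u1 + btens y u2.
Proof. by rewrite /btens tensPr !linearP. Qed.

(** An element of the quotient is its own representative in the complement; expanding it in basis
    tensors and projecting writes it as a combination of elements [btens y u]. *)
Lemma btens_ind (P : AeeA e -> Prop) :
  (forall a s t, P s -> P t -> P (a *: s + t)) ->
  (forall y u, P (btens y u)) -> forall t, P t.
Proof.
move=> PD Pb t.
(* Zero is obtained as [- s + s] for a pure tensor [s]. *)
have P0 : P 0 by rewrite -(addNr (btens 0 0)) -scaleN1r; apply: PD.
have dC : ((balance_rel e)^C :&: balance_rel e = 0)%VS.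
  by rewrite capvC capv_compl.
have -> : t = \sum_i \sum_j (vsval t : 'M_(_, _)) i j *:
    btens (vbasis {:Ae e})`_i (vbasis {:eA e})`_j.
  have tE : t = vsproj _ (daddv_pi (balance_rel e)^C (balance_rel e) (vsval t)).
    by rewrite daddv_pi_id ?subvsP // vsvalK.
  rewrite {1}tE {1}[vsval t]tens_sum.
  rewrite !linear_sum; apply: eq_bigr => i _.
  by rewrite !linear_sum; apply: eq_bigr => j _; rewrite /btens !linearZ.
elim/big_ind: _ => // [s1 s2 P1 P2|i _].
  by rewrite -[s1]scale1r; apply: PD.
elim/big_ind: _ => // [s1 s2 P1 P2|j _].
  by rewrite -[s1]scale1r; apply: PD.
by rewrite -[X in P X]addr0; apply: PD.
Qed.

(** The map [mu] of the overview, computed on the representative in the complement; associativity of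
    [A] is the balancedness that yields its value on [btens y u]. *)
Definition AeeA_mul_fun (t : AeeA e) : A :=
  tlift (fun y u => vsval y * vsval u) (vsval t).

Lemma vsval_mul_bilinear :
  bilinear_map (fun (y : Ae e) (u : eA e) => vsval y * vsval u).
Proof.
split=> [y | u] a x z; first by rewrite linearP mulrDr scalerAr.
by rewrite linearP mulrDl scalerAl.
Qed.

Lemma AeeA_mul_fun_linear : linear AeeA_mul_fun.
Proof. by move=> a s t; rewrite /AeeA_mul_fun linearP tlift_linear. Qed.

Definition AeeA_mul : 'Hom(AeeA e, A) := mk_hom AeeA_mul_fun_linear.

Lemma AeeA_mul_btens y u : AeeA_mul (btens y u) = vsval y * vsval u.
Proof.
rewrite mk_homE /AeeA_mul_fun tlift_btens //; first exact: vsval_mul_bilinear.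
by move=> y1 c u1; rewrite vsval_Ae_ract vsval_eA_lact mulrA.
Qed.

End Idempotent.

(** * The product [m] on [D(A)] and its units *)

Section Counit.
Variables (k : fieldType) (A : falgType k) (e : A).
Hypothesis he : e * e = e.
Variables (sigma : 'AEnd(A)) (tau : 'Hom(eA e, dual (Ae e))).
Hypothesis htau : eA_twist_iso sigma tau.
Variable gamma : 'Hom(AeeA e, dual A).
Hypothesis hgamma : is_gamma sigma tau gamma.
Variable m : 'Hom(tensor (dual A) (dual A), dual A).
Hypothesis hm : is_mult gamma m.
Implicit Types (y : Ae e) (u : eA e) (s t : AeeA e) (f g : dual A).

Lemma gamma_btens y u x : gamma (btens y u) x = tau (eA_ract u (sigma x)) y.
Proof.
have := hgamma (vsval y) (vsval u) x.
by rewrite (in_Ae_vsval he) (in_eA_vsval he).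
Qed.

(** At [x] the left side is [tau(u sigma(x) sigma(a))(y)], and the twisted linearity of [tau] turns
    it into [tau(u sigma(x))(a y)]. *)
Lemma gamma_lact a y u :
  dual_lact a (gamma (btens y u)) = gamma (btens (Ae_lact a y) u).
Proof.
have [_ tauP] := htau; apply/lfunP => x; rewrite dual_lactE !gamma_btens.
have := tauP (eAe_one e) (eA_ract u (sigma x)) a y.
rewrite eA_lact1 // Ae_ract1 // => <-; congr (tau _ _); apply: subvs_inj.
by rewrite !vsval_eA_ract // rmorphM mulrA.
Qed.

Lemma gamma_surj (e_faithful : faithful_idempotent e)
    (sigma_bij : bijective sigma) f : exists t, f = gamma t.
Proof.
suff /memv_imgP[t _ ->] : f \in limg gamma by exists t.
have -> : limg gamma = fullv; last exact: memvf.
(* If every [gamma t] kills [x], then [tau(u sigma(x)) = 0] for all [u], so [sigma(x)] annihilates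
   [eA]. *)
apply: separating_forms_full => x gx0.
have [tau_bij _] := htau; have [_ eA_faith] := e_faithful.
apply: (bij_inj sigma_bij); rewrite rmorph0; apply: eA_faith => u.
apply: (bij_inj tau_bij); rewrite linear0; apply/lfunP => y.
by rewrite -gamma_btens zero_lfunE gx0 // memv_img ?memvf.
Qed.

Lemma mult_btens y u y' u' :
  m (tens (gamma (btens y u)) (gamma (btens y' u')))
    = gamma (btens (Ae_lact (vsval y * vsval u) y') u').
Proof.
have := hm (vsval y) (vsval u) (vsval y') (vsval u').
rewrite !(in_Ae_vsval he) !(in_eA_vsval he) => ->; congr (gamma (btens _ _)).
apply: subvs_inj; rewrite vsval_Ae_lact // vsval_in_Ae // vsval_Ae_idem //.
by rewrite -!mulrA vsval_Ae_idem.
Qed.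

(** With [f = gamma t'], both sides equal [gamma(y u y' (x) u')] on pure tensors; linearity does the
    rest. *)
Lemma mult_gammal t f (e_faithful : faithful_idempotent e)
    (sigma_bij : bijective sigma) :
  m (tens (gamma t) f) = dual_lact (AeeA_mul e t) f.
Proof.
have [t' ->] := gamma_surj e_faithful sigma_bij f.
elim/btens_ind: t => [a s t IHs IHt | y u].
  rewrite !hom_linearP tensPl hom_linearP IHs IHt; apply/lfunP => x.
  by rewrite add_lfunE scale_lfunE !dual_lactE mulrDr -scalerAr hom_linearP.
elim/btens_ind: t' => [a s t IHs IHt | y' u'].
  by rewrite hom_linearP tensPr hom_linearP IHs IHt dual_lactP.
by rewrite mult_btens gamma_lact AeeA_mul_btens.
Qed.

(** By [mult_gammal] this reduces to the left linearity of [mu]. *)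
Lemma mult_lact a g f (e_faithful : faithful_idempotent e)
    (sigma_bij : bijective sigma) :
  m (tens (dual_lact a g) f) = dual_lact a (m (tens g f)).
Proof.
have gl t h := mult_gammal t h e_faithful sigma_bij.
have [t ->] := gamma_surj e_faithful sigma_bij g.
elim/btens_ind: t => [b s t IHs IHt | y u].
  by rewrite hom_linearP dual_lactP !tensPl !hom_linearP IHs IHt dual_lactP.
rewrite gamma_lact !gl !AeeA_mul_btens // vsval_Ae_lact // -mulrA.
exact: dual_lactM.
Qed.

(** The balanced counterpart of [mult_gammal], from which the right unit law follows. *)
Lemma mult_gammar y u t :
  m (tens (gamma (btens y u)) (gamma t))
    = gamma (btens y (eA_ract u (AeeA_mul e t))).
Proof.
elim/btens_ind: t => [a s t IHs IHt | y' u'].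
  rewrite hom_linearP tensPr !hom_linearP IHs IHt /eA_ract.
  by rewrite mulrDr -scalerAr linearP btensPr hom_linearP.
rewrite mult_btens AeeA_mul_btens //.
(* Since [u y'] lies in [eAe], it crosses the tensor sign: [y (u y') (x) u' = y (x) (u y') u']. *)
pose c : eAe e := vsproj _ (vsval u * vsval y').
have cE : vsval c = vsval u * vsval y'.
  rewrite vsprojK //; apply/memv_imgP; exists (vsval u * vsval y').
    by rewrite memvf.
  rewrite comp_lfunE !lfunE /= -mulrA (vsval_Ae_idem he).
  by rewrite mulrA (vsval_eA_idem he).
have -> : Ae_lact (vsval y * vsval u) y' = Ae_ract y c.
  by apply: subvs_inj; rewrite vsval_Ae_lact // vsval_Ae_ract // cE mulrA.
rewrite btens_balanced; congr (gamma (btens _ _)); apply: subvs_inj.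
by rewrite vsval_eA_lact // vsval_eA_ract // cE mulrA.
Qed.

(** As [is_comult] exchanges the factors, [(d (x) 1) Delta = id] matches the right unit law and
    [(1 (x) d) Delta = id] the left one. *)
Lemma counit_unit (Delta : 'Hom(A, tensor A A)) (hDelta : is_comult m Delta)
    (d : dual A) :
  is_counit Delta d <->
  (forall f, m (tens f d) = f) /\ (forall f, m (tens d f) = f).
Proof.
split=> [[dl dr] | [dl dr]]; split.
- by move=> f; apply/lfunP => x; rewrite -hDelta form_tensE dl.
- by move=> f; apply/lfunP => x; rewrite -hDelta tens_formE dr.
- move=> x; apply/eqP; rewrite -subr_eq0; apply/eqP/dual_separates => f.
  by rewrite linearB /= -form_tensE hDelta dl subrr.
- move=> x; apply/eqP; rewrite -subr_eq0; apply/eqP/dual_separates => f.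
  by rewrite linearB /= -tens_formE hDelta dr subrr.
Qed.

End Counit.

(** * The ideal [AeA] and the equivalence *)

Lemma frobenius_AeeA_mul_full (k : fieldType) (A : falgType k) (e : A)
    (he : e * e = e) (e_faithful : faithful_idempotent e) :
  frobenius A -> limg (AeeA_mul e) = fullv.
Proof.
move=> [phi [phi_bij phiM]]; apply: forms_vanishing_full => f f0.
have [phi' _ phi'K] := phi_bij; pose a := phi' f.
have fE : f = phi a by rewrite phi'K.
suff a0 : a = 0 by rewrite fE a0 linear0.
have [_ eA_faith] := e_faithful; apply: eA_faith => u.
apply: subvs_inj; rewrite vsval_eA_ract // linear0.
apply: (bij_inj phi_bij); rewrite linear0; apply/lfunP => x.
rewrite phiM -fE dual_lactE zero_lfunE.
(* From [u = e u], the product [x u = (x e) u] lies in [AeA], where [f] vanishes. *)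
have -> : x * vsval u = AeeA_mul e (btens (in_Ae e x) u).
  by rewrite AeeA_mul_btens // vsval_in_Ae // -mulrA vsval_eA_idem.
by apply: f0; rewrite memv_img ?memvf.
Qed.

Theorem proposition4p14 (k : fieldType) (A : falgType k)
    (hA : gendo_frobenius A)
    (e : A) (he : e * e = e)
    (he_faithful : faithful_idempotent e)
    (he_dual : self_dual_idempotent e)
    (sigma : 'AEnd(A)) (hsigma : bijective sigma)
    (tau : 'Hom(eA e, dual (Ae e))) (htau : eA_twist_iso sigma tau)
    (gamma : 'Hom(AeeA e, dual A)) (hgamma : is_gamma sigma tau gamma)
    (m : 'Hom(tensor (dual A) (dual A), dual A)) (hm : is_mult gamma m)
    (Delta : 'Hom(A, tensor A A)) (hDelta : is_comult m Delta) :
  (exists delta : dual A, is_counit Delta delta) <-> frobenius A.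
Proof.
have g_surj := gamma_surj he htau hgamma he_faithful hsigma.
have gl t f := mult_gammal he htau hgamma hm t f he_faithful hsigma.
split=> [[d /(counit_unit hDelta)[_ dl]] | frobA].
  apply: (frobenius_generator (d := d)) => a ad0; apply: dual_separates => f.
  have := mult_lact he htau hgamma hm a d f he_faithful hsigma.
  (* Here [0] is written as [- 0 + 0] so that linearity of [tens] gives [m(0 (x) f) = 0]; hence
     [a f = 0]. *)
  rewrite dl ad0 -[0 in LHS](addNr 0) -scaleN1r tensPl scaleN1r addNr linear0.
  (* Evaluating [a f] at [1] gives [f a]. *)
  by move/(congr1 (fun g : dual A => g 1)); rewrite zero_lfunE dual_lactE mul1r.
have /memv_imgP[t _ t1] : 1 \in limg (AeeA_mul e).
  by rewrite frobenius_AeeA_mul_full ?memvf.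
exists (gamma t); apply/(counit_unit hDelta); split=> f; last first.
  by rewrite gl -t1; apply/lfunP => x; rewrite dual_lactE mulr1.
(* On pure tensors, [m(gamma(y (x) u) (x) gamma t) = gamma(y (x) u mu(t))] and [mu(t) = 1]. *)
have [s ->] := g_surj f; elim/btens_ind: s => [a s1 s2 IH1 IH2 | y u].
  by rewrite hom_linearP tensPl hom_linearP IH1 IH2.
rewrite (mult_gammar he hm) -t1; congr (gamma (btens _ _)); apply: subvs_inj.
by rewrite vsval_eA_ract // mulr1.
Qed.
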